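(* Let $p$ be a prime and let $(A,+,\cdot)$ be a pre-Lie algebra over $\mathbb{F}_p$ with $(A,+)\cong C_p^5$, generated by a single element $x$ as a pre-Lie algebra. Suppose $A^{[7]}\neq 0$, $A^{[8]}=0$ and $A^{[5]}=A^{[4]}$. Then the following hold. (1) The elements $x,\ x^2,\ x^2\cdot x,\ x^2\cdot(x^2\cdot x),\ x^2\cdot(x^2\cdot(x^2\cdot x))$ form a basis of $A$ as an $\mathbb{F}_p$-vector space. (2) $x\cdot x^2\in A^{[4]}$. (3) There exist $\alpha_1,\alpha_2\in\mathbb{F}_p$ such that $x\cdot(x^2\cdot x)-\alpha_1\,x^2\cdot(x^2\cdot x)\in A^{[6]}$ and $(x^2\cdot x)\cdot x-\alpha_2\,x^2\cdot(x^2\cdot x)\in A^{[6]}$. Also $(x^2\cdot x)\cdot x-x^2\cdot x^2=(x\cdot x^2)\cdot x-x\cdot(x^2\cdot x)$. (4) $x\cdot(x\cdot(x\cdot x^2))=(x\cdot(x\cdot x^2))\cdot x=x\cdot((x\cdot x^2)\cdot x)=((x\cdot x^2)\cdot x)\cdot x=(x\cdot x^2)\cdot x^2=0$. (5) Among the products of six copies of $x$ (in all possible bracketings), which are the generators of $A^{[6]}$, the only possibly non-zero ones are $x\cdot(x^2\cdot(x^2\cdot x))$, $(x^2\cdot(x^2\cdot x))\cdot x$, $x^2\cdot(x\cdot(x^2\cdot x))$, $x^2\cdot((x^2\cdot x)\cdot x)$, $x^2\cdot(x^2\cdot x^2)$, $(x^2\cdot x)\cdot(x^2\cdot x)$, $((x^2\cdot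 x)\cdot x)\cdot x^2$, $(x\cdot(x^2\cdot x))\cdot x^2$; all the others are $0$. (6) $A^{[7]}=A^{[6]}=\mathbb{F}_p\,x^2\cdot(x^2\cdot(x^2\cdot x))$, $A^{[5]}/A^{[6]}=A^{[4]}/A^{[6]}=\mathbb{F}_p\,x^2\cdot(x^2\cdot x)$, and $A^{[3]}/A^{[4]}=\mathbb{F}_p\,(x^2\cdot x)$.
   Context: A pre-Lie algebra over $\mathbb{F}_p$ is an $\mathbb{F}_p$-vector space $A$ with a bilinear product $\cdot$ satisfying $(a\cdot b)\cdot c-a\cdot(b\cdot c)=(b\cdot a)\cdot c-b\cdot(a\cdot c)$ for all $a,b,c\in A$. For subspaces $B,C\subseteq A$, $B\cdot C$ denotes the subspace spanned by all $b\cdot c$ with $b\in B$, $c\in C$. Define $A^{[1]}=A$ and $A^{[i+1]}=\sum_{j=1}^{i}A^{[j]}\cdot A^{[i+1-j]}$ for $i\ge 1$. Write $x^2=x\cdot x$. For $a\in A$, $A^{[i]}=\mathbb{F}_p\,a$ means $A^{[i]}$ is spanned by $a$, and $A^{[i]}/A^{[j]}=\mathbb{F}_p\,a$ means the quotient is spanned by the image of $a\in A^{[i]}$.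
   Formalization: In (5), ''which are the generators of A^[6]'' is proved only modulo A^[7]; literally it is false: for basis x,y,z,w,u with xx=y, yx=z, yz=w, yw=u and other products 0, all products of six copies of x vanish but A^[6] is spanned by u. *)

(* Defs.v *)
From HB Require Import structures.
From mathcomp Require Import all_boot all_order all_algebra.

Set Implicit Arguments.
Unset Strict Implicit.
Unset Printing Implicit Defensive.

Import GRing.Theory.
Local Open Scope ring_scope.

HB.mixin Record Lmodule_isPreLie (F : fieldType) A of GRing.Lmodule F A := {
  plmul : A -> A -> A;
  plmulDl : left_distributive plmul +%R;
  plmulDr : right_distributive plmul +%R;
  plmulZl : forall (k : F) (a b : A), plmul (k *: a) b = k *: plmul a b;
  plmulZr : forall (k : F) (a b : A), plmul a (k *: b) = k *: plmul a b;
  plmul_assocC : forall a b c : A,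
    plmul (plmul a b) c - plmul a (plmul b c) =
    plmul (plmul b a) c - plmul b (plmul a c)
}.

#[short(type="preLieType")]
HB.structure Definition PreLie (F : fieldType) :=
  { A of Lmodule_isPreLie F A & GRing.Lmodule F A }.

(* Finite-dimensional pre-Lie algebras; subspaces are then {vspace A}. *)
#[short(type="preLieVectType")]
HB.structure Definition PreLieVect (F : fieldType) :=
  { A of Lmodule_isPreLie F A & Vector F A }.

Declare Scope prelie_scope.
Delimit Scope prelie_scope with PL.
Notation "a ** b" := (plmul a b) (at level 40, no associativity) : prelie_scope.

Section PreLieSubspaces.
Variables (F : fieldType) (A : preLieVectType F).
Implicit Types (U V W B C : {vspace A}) (a b c u v x : A).
Local Open Scope prelie_scope.

(* As for products of subspaces of an algebra in the library, spanning by
   products of basis vectors is enough; plprodvP is the characterisation as the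
   span of all products. *)
Definition plprodv B C : {vspace A} :=
  <<[seq b ** c | b <- vbasis B, c <- vbasis C]>>%VS.

Lemma plmul_suml I (r : seq I) (f : I -> A) b :
  (\sum_(i <- r) f i) ** b = \sum_(i <- r) f i ** b.
Proof.
elim: r => [|i r IHr]; last by rewrite !big_cons plmulDl IHr.
by rewrite !big_nil -(scale0r 0) plmulZl !scale0r.
Qed.

Lemma plmul_sumr I (r : seq I) (f : I -> A) a :
  a ** (\sum_(i <- r) f i) = \sum_(i <- r) a ** f i.
Proof.
elim: r => [|i r IHr]; last by rewrite !big_cons plmulDr IHr.
by rewrite !big_nil -(scale0r 0) plmulZr !scale0r.
Qed.

Lemma memv_plmul B C b c : b \in B -> c \in C -> b ** c \in plprodv B C.
Proof.
move=> /coord_vbasis-> /coord_vbasis->.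
rewrite plmul_suml; apply: memv_suml => i _.
rewrite plmul_sumr; apply: memv_suml => j _.
rewrite plmulZl plmulZr !memvZ // memv_span //.
by apply/allpairsP; exists ((vbasis B)`_i, (vbasis C)`_j);
  rewrite !mem_nth ?size_tuple.
Qed.

Lemma plprodvP B C W :
  reflect (forall b c, b \in B -> c \in C -> b ** c \in W)
          (plprodv B C <= W)%VS.
Proof.
apply: (iffP idP) => [/subvP sW b c Bb Cc | sW]; first exact/sW/memv_plmul.
apply/span_subvP => _ /allpairsP[[b c] /= [Bb Cc ->]].
by rewrite sW ?vbasis_mem.
Qed.

(* plpow_seq n lists A^[1], ..., A^[n+1]. *)
Fixpoint plpow_seq (n : nat) : seq {vspace A} :=
  if n is m.+1 then
    let s := plpow_seq m in
    rcons s (\sum_(k < m.+1) plprodv (nth 0%VS s k) (nth 0%VS s (m - k)))%VS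
  else [:: fullv].

(* A^[i] for i >= 1; the value at i = 0 is irrelevant. The defining recursion
   is plpow1 and plpowS. *)
Definition plpow (i : nat) : {vspace A} := nth 0%VS (plpow_seq i.-1) i.-1.

Lemma size_plpow_seq n : size (plpow_seq n) = n.+1.
Proof. by elim: n => //= n IHn; rewrite size_rcons IHn. Qed.

Lemma nth_plpow_seq n k : (k <= n)%N -> nth 0%VS (plpow_seq n) k = plpow k.+1.
Proof.
elim: n => [|n IHn]; first by rewrite leqn0 => /eqP->.
rewrite leq_eqVlt => /predU1P[-> // | lekn].
by rewrite /= nth_rcons size_plpow_seq lekn IHn.
Qed.

Lemma plpow1 : plpow 1 = fullv.
Proof. by []. Qed.

Lemma plpowS i : (0 < i)%N ->
  plpow i.+1 = (\sum_(1 <= j < i.+1) plprodv (plpow j) (plpow (i.+1 - j)))%VS.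
Proof.
case: i => // n _.
rewrite {1}/plpow /= nth_rcons size_plpow_seq ltnn eqxx big_add1 /= big_mkord.
apply: eq_bigr => k _; have lekn : (k <= n)%N by rewrite -ltnS.
by rewrite !nth_plpow_seq ?leq_subr // subSS subSn.
Qed.

Definition plgenerates x : Prop :=
  forall U : {vspace A}, x \in U ->
    (forall u v, u \in U -> v \in U -> u ** v \in U) -> U = fullv.

(* U / V = F a: the image of a in U spans the quotient. *)
Definition quot_span1 U V a : Prop :=
  [/\ (V <= U)%VS, a \in U &
      forall u, u \in U -> exists k : F, u - k *: a \in V].

End PreLieSubspaces.

(* Formal bracketings of copies of one letter, i.e. the free magma on it. *)
Inductive bracketing : Type :=
  | Leaf
  | Node of bracketing & bracketing.

Fixpoint bracketing_eq (s t : bracketing) : bool :=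
  match s, t with
  | Leaf, Leaf => true
  | Node s1 s2, Node t1 t2 => bracketing_eq s1 t1 && bracketing_eq s2 t2
  | _, _ => false
  end.

Lemma bracketing_eqP : Equality.axiom bracketing_eq.
Proof.
elim=> [|s1 IH1 s2 IH2] [|t1 t2] /=; try by constructor.
apply: (iffP andP) => [[/IH1-> /IH2->] // | [<- <-]].
by split; [apply/IH1 | apply/IH2].
Qed.

HB.instance Definition _ := hasDecEq.Build bracketing bracketing_eqP.

Fixpoint nleaves (t : bracketing) : nat :=
  if t is Node s1 s2 then (nleaves s1 + nleaves s2)%N else 1%N.

Fixpoint plval (F : fieldType) (A : preLieType F) (x : A) (t : bracketing) : A :=
  if t is Node s1 s2 then plmul (plval x s1) (plval x s2) else x.

Declare Scope bracketing_scope.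
Delimit Scope bracketing_scope with BKT.
Bind Scope bracketing_scope with bracketing.
Notation "s ** t" := (Node s t) (at level 40, no associativity) : bracketing_scope.

(* Main.v *)
Require Import Defs.
From HB Require Import structures.
From mathcomp Require Import all_boot all_order all_algebra.
From mathcomp Require Import zify.

Set Implicit Arguments.
Unset Strict Implicit.
Unset Printing Implicit Defensive.

Import GRing.Theory.
Local Open Scope ring_scope.
Local Open Scope prelie_scope.

(** Write P_i for A^[i]. The P_i form a decreasing filtration with
    P_i ** P_j inside P_(i+j), so the layers P_i / P_(i+1) form a graded
    pre-Lie algebra generated by the class of x; layer 4 vanishes by hypothesis
    and layer 7 does not.

    Two consequences of the pre-Lie identity do all the work. First, moving the
    left factor inwards, u (r s) = r (u s) + (u r) s - (r u) s, shows that if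
    layers 4 and 5 vanish then so does the product of layer 3 with itself, hence
    layer 6 ([plpow6_stable]) and then layer 7. So layer 5 is nonzero. Layers 1,
    2 and 3 are nonzero because otherwise every later layer vanishes (for layer
    3 because layer 4 is zero as well). With the
    nonzero layer 7 this makes five nonzero layers in dimension 5: layers
    1, 2, 3, 5, 7 are lines and layer 6 is zero ([plpow_dims]).

    Second, u (x x) = x (u x) + (u x) x - (x u) x shows that multiplication on
    the right by x^2 sends layer k to zero as soon as layer k + 1 vanishes
    ([plmul_sqr_right]). As layers 4 and 6 vanish, right multiplication by x^2
    kills layers 3 and 5. Hence layer 5 can come only from x^2 (x^2 x) and layer
    7 only from x^2 (x^2 (x^2 x)), the candidate x^2 (x x^2) for layer 5 being
    excluded by the same identity. So x^2 x spans layer 3, and writing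
    x x^2 = k (x^2 x) modulo P_4 and multiplying on the left by x^2 gives k = 0.
    This provides the basis, the position of x x^2 and the quotients.

    The vanishing statements are then bookkeeping. Since the even layers from 4
    on are zero, since x x^2 lies in P_5, and since right multiplication by x^2
    raises the index by one more than expected, each bracketing t has a
    computable index [plweight t] for which its value lies in P_(plweight t);
    when this index is at least 8 the value is 0. Inspecting the 42 bracketings
    of six letters, every one outside the eight listed has such an index. *)

(** * The power filtration of a pre-Lie algebra *)

Section PowerFiltration.
Variables (F : fieldType) (A : preLieVectType F).
Implicit Types (u v w x : A) (U V W : {vspace A}).

Lemma plmulCA u v w :
  u ** (v ** w) = v ** (u ** w) + (u ** v) ** w - (v ** u) ** w.
Proof.
have /eqP := plmul_assocC u v w; rewrite subr_eq => /eqP->.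
by rewrite addrA subrKC [_ + u ** _]addrC addrK.
Qed.

Lemma plmul_linear u : linear (plmul u : A -> A).
Proof. by move=> k v w; rewrite plmulDr plmulZr. Qed.

HB.instance Definition _ u :=
  GRing.isLinear.Build F A A *:%R (plmul u : A -> A) (plmul_linear u).

Lemma plmul_vline U a b u v :
  u \in <[a]>%VS -> v \in <[b]>%VS -> a ** b \in U -> u ** v \in U.
Proof.
by move=> /vlineP[k ->] /vlineP[l ->] Uab; rewrite plmulZl plmulZr !rpredZ.
Qed.

Lemma plmul_span U (X Y : seq A) u v :
  {in X & Y, forall a b, a ** b \in U} ->
  u \in <<X>>%VS -> v \in <<Y>>%VS -> u ** v \in U.
Proof.
move=> XY /(@coord_span _ _ _ (in_tuple X))->.
move=> /(@coord_span _ _ _ (in_tuple Y))->.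
rewrite plmul_suml; apply: memv_suml => i _.
rewrite plmul_sumr; apply: memv_suml => j _.
by rewrite plmulZl plmulZr !rpredZ // XY ?mem_nth.
Qed.

Lemma plpowS_sub n W : (0 < n)%N ->
  (forall i j u v, (0 < i)%N -> (0 < j)%N -> (i + j = n.+1)%N ->
     u \in plpow A i -> v \in plpow A j -> u ** v \in W) ->
  (plpow A n.+1 <= W)%VS.
Proof.
move=> n_gt0 sW; rewrite plpowS // big_nat; elim/big_ind: _ => [|U V|i].
- exact: sub0v.
- by rewrite subv_add => -> ->.
move=> /andP[i_gt0 lt_i]; apply/plprodvP => u v Pu Pv.
by apply: (sW i (n.+1 - i)%N) => //; lia.
Qed.

Lemma plpow_mul i j u v : (0 < i)%N -> (0 < j)%N ->
  u \in plpow A i -> v \in plpow A j -> u ** v \in plpow A (i + j).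
Proof.
move=> i_gt0 j_gt0 Pu Pv; have ->: (i + j = (i + j).-1.+1)%N by lia.
rewrite plpowS; last by lia.
have i_in : i \in index_iota 1 (i + j).-1.+1 by rewrite mem_index_iota; lia.
rewrite (bigD1_seq i i_in (iota_uniq _ _)) /=.
apply: (subvP (addvSl _ _)); apply: memv_plmul => //.
by have ->: ((i + j).-1.+1 - i = j)%N by lia.
Qed.

Lemma plpowSS n : (plpow A n.+1 <= plpow A n)%VS.
Proof.
elim/ltn_ind: n => -[|[|n]] IHn; rewrite ?subvf //.
apply: plpowS_sub => // -[//|[|i]] [//|j] u v _ _ def_n Pu Pv.
  have def_j : j = n.+1 by lia.
  subst j; have ->: n.+2 = (1 + n.+1)%N by lia.
  by apply: plpow_mul => //; apply: (subvP (IHn n.+1 _)).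
have ->: n.+2 = (i.+1 + j.+1)%N by lia.
by apply: plpow_mul => //; apply: (subvP (IHn i.+1 _)) => //; lia.
Qed.

Lemma plpow_sub m n : (m <= n)%N -> (plpow A n <= plpow A m)%VS.
Proof.
move=> /subnKC <-; elim: (n - m)%N => [|k IHk]; first by rewrite addn0.
by rewrite addnS; apply: subv_trans (plpowSS _) IHk.
Qed.

Lemma plpow_mul_ge n i j u v : (0 < i)%N -> (0 < j)%N -> (n <= i + j)%N ->
  u \in plpow A i -> v \in plpow A j -> u ** v \in plpow A n.
Proof.
move=> i_gt0 j_gt0 len Pu Pv.
by apply: (subvP (plpow_sub len)); apply: plpow_mul.
Qed.

(** If in every splitting i + j = n + 1 one of the layers i, j is zero, layer
    n + 1 is zero, being spanned by products of the two. *)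
Lemma plpowS_stable n : (0 < n)%N ->
  (forall i j, (0 < i)%N -> (0 < j)%N -> (i + j = n.+1)%N ->
     (plpow A i <= plpow A i.+1)%VS \/ (plpow A j <= plpow A j.+1)%VS) ->
  (plpow A n.+1 <= plpow A n.+2)%VS.
Proof.
move=> n_gt0 st; apply: plpowS_sub => // i j u v i_gt0 j_gt0 def_n Pu Pv.
have [/subvP si | /subvP sj] := st i j i_gt0 j_gt0 def_n.
  by apply: (@plpow_mul_ge _ i.+1 j) => //; [lia | apply: si].
by apply: (@plpow_mul_ge _ i j.+1) => //; [lia | apply: sj].
Qed.

(** Generators of the layers: if S i spans layer i for i <= n, products of
    elements of the S i span layer n + 1, because replacing a factor by a
    representative modulo the next power changes the product only by an element
    of P_(n+2). *)
Lemma plpowS_cover n (S : nat -> {vspace A}) W : (0 < n)%N ->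
  (forall i, (0 < i <= n)%N -> (plpow A i <= S i + plpow A i.+1)%VS) ->
  (forall i j u v, (0 < i)%N -> (0 < j)%N -> (i + j = n.+1)%N ->
     u \in S i -> v \in S j -> u ** v \in W) ->
  (plpow A n.+1 <= W + plpow A n.+2)%VS.
Proof.
move=> n_gt0 sS sW; apply: plpowS_sub => // i j u v i_gt0 j_gt0 def_n Pu Pv.
have /memv_addP[s Ss [r Pr def_u]] : u \in (S i + plpow A i.+1)%VS.
  by apply: (subvP (sS i _)) => //; lia.
have /memv_addP[s' Ss' [r' Pr' def_v]] : v \in (S j + plpow A j.+1)%VS.
  by apply: (subvP (sS j _)) => //; lia.
have Ps : s \in plpow A i.
  have ->: s = u - r by rewrite def_u addrK.
  by rewrite rpredB // (subvP (plpowSS i)).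
have ->: u ** v = s ** s' + (s ** r' + r ** v).
  by rewrite {1}def_u plmulDl {1}def_v plmulDr addrA.
apply: memv_add; first exact: (sW i j).
rewrite rpredD //.
  by apply: (@plpow_mul_ge _ i j.+1) => //; lia.
by apply: (@plpow_mul_ge _ i.+1 j) => //; lia.
Qed.

Lemma plgen_cover x : plgenerates x -> (plpow A 1 <= <[x]> + plpow A 2)%VS.
Proof.
move=> x_gen; rewrite [(_ + _)%VS]x_gen ?subvf //.
  by rewrite (subvP (addvSl _ _)) ?memv_line.
move=> u v _ _; rewrite (subvP (addvSr _ _)) //.
by apply: (@plpow_mul 1 1); rewrite ?memvf.
Qed.

(** Since u (x x) = x (u x) + (u x) x - (x u) x and u x, x u drop one step
    further down when layer k + 1 is zero, so does u (x x). *)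
Lemma plmul_sqr_right k u x : (0 < k)%N ->
  (plpow A k.+1 <= plpow A k.+2)%VS ->
  u \in plpow A k -> u ** (x ** x) \in plpow A k.+3.
Proof.
move=> k_gt0 /subvP st Pu; have Px : x \in plpow A 1 by apply: memvf.
have Pux : u ** x \in plpow A k.+2.
  by apply: st; apply: (@plpow_mul_ge _ k 1) => //; lia.
have Pxu : x ** u \in plpow A k.+2.
  by apply: st; apply: (@plpow_mul_ge _ 1 k) => //; lia.
rewrite plmulCA rpredB ?rpredD //.
- by apply: (@plpow_mul_ge _ 1 k.+2) => //; lia.
- by apply: (@plpow_mul_ge _ k.+2 1) => //; lia.
- by apply: (@plpow_mul_ge _ k.+2 1) => //; lia.
Qed.

(** The only way to reach layer 6 while layers 4 and 5 vanish is a product of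
    two elements of P_3. Decompose the right factor as y z with {y, z} in
    P_1, P_2: in y (u z) + (u y) z - (y u) z each inner product lies in P_4,
    hence in P_6, so each term lies in P_7. *)
Lemma plpow6_stable : (plpow A 4 <= plpow A 5)%VS ->
  (plpow A 5 <= plpow A 6)%VS -> (plpow A 6 <= plpow A 7)%VS.
Proof.
move=> P45 P56; have P46 := subv_trans P45 P56.
apply: plpowS_sub => // i j u v i_gt0 j_gt0 def_ij Pu Pv.
have [def_i|neq33] := altP (i =P 3%N); last first.
  have: (3 < i <= 5)%N \/ (3 < j <= 5)%N by lia.
  have P6 k : (3 < k <= 5)%N -> (plpow A k <= plpow A 6)%VS.
    by case: k => [|[|[|[|[|[|k]]]]]].
  case=> /P6/subvP P6ij.
    by apply: (@plpow_mul_ge _ 6 j) => //; apply: P6ij.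
  by apply: (@plpow_mul_ge _ i 6) => //; [lia | apply: P6ij].
have def_j : j = 3%N by lia.
(* The preimage of P_7 under left multiplication by u is a subspace, so only
   the generators y ** z of P_3 matter. *)
subst i j; suff: (plpow A 3 <= linfun (plmul u : A -> A) @^-1: plpow A 7)%VS.
  by move=> /subvP/(_ v Pv); rewrite -memv_preim lfunE.
apply: plpowS_sub => // r s y z r_gt0 s_gt0 def_rs Py Pz.
rewrite -memv_preim lfunE /= plmulCA rpredB ?rpredD //.
- apply: (@plpow_mul_ge _ r 6) => //; first by lia.
  by apply: (subvP P46); apply: (@plpow_mul_ge _ 3 s) => //; lia.
- apply: (@plpow_mul_ge _ 6 s) => //.
  by apply: (subvP P46); apply: (@plpow_mul_ge _ 3 r) => //; lia.
- apply: (@plpow_mul_ge _ 6 s) => //.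
  by apply: (subvP P46); apply: (@plpow_mul_ge _ r 3) => //; lia.
Qed.

End PowerFiltration.

(** * Dimension count *)

Lemma dimv_lt (F : fieldType) (V : vectType F) (U W : {vspace V}) :
  (U <= W)%VS -> ~~ (W <= U)%VS -> (\dim U < \dim W)%N.
Proof.
move=> sUW nsWU; rewrite ltn_neqAle dimvS // andbT.
by apply: contra nsWU; rewrite (dimv_leqif_sup sUW).
Qed.

Lemma subv_line_add (F : fieldType) (V : vectType F) (U W : {vspace V}) a :
  (U <= W)%VS -> (\dim W <= (\dim U).+1)%N -> a \in W -> a \notin U ->
  (W <= <[a]> + U)%VS.
Proof.
move=> sUW dimW Wa Ua.
have s_aU_W : (<[a]> + U <= W)%VS by rewrite subv_add sUW andbT -memvE.
rewrite -(dimv_leqif_sup s_aU_W) eqn_leq dimvS //=.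
apply: leq_trans dimW _; apply: dimv_lt; first exact: addvSr.
by apply: contra Ua => /subvP; apply; rewrite (subvP (addvSl _ _)) ?memv_line.
Qed.

(** * The structure of the layers *)

Section GradedThinness.
Variables (F : fieldType) (A : preLieVectType F) (x : A).
Hypotheses (x_gen : plgenerates x) (dimA : \dim {:A} = 5%N).
Hypotheses (P7_neq0 : plpow A 7 <> 0%VS) (P8_eq0 : plpow A 8 = 0%VS).
Hypothesis P45 : (plpow A 4 <= plpow A 5)%VS.

Local Notation P := (plpow A).
Local Notation x2 := (x ** x).
Local Notation a := (x2 ** x).
Local Notation b := (x ** x2).
Local Notation c := (x2 ** a).
Local Notation d := (x2 ** c).

Lemma plpow_ge8 n : (7 < n)%N -> P n = 0%VS.
Proof. by move=> ngt7; apply/eqP; rewrite -subv0 -P8_eq0 plpow_sub. Qed.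

Let P7_stable_false : ~ (P 7 <= P 8)%VS.
Proof. by rewrite P8_eq0 subv0 => /eqP/P7_neq0. Qed.

Lemma plpow_drop1 : ~~ (P 1 <= P 2)%VS.
Proof.
apply/negP => P12; have all_st n : (0 < n)%N -> (P n <= P n.+1)%VS.
  elim/ltn_ind: n => -[|[|n]] IHn // _; apply: plpowS_stable => // i j *.
  by left; apply: IHn => //; lia.
exact: P7_stable_false (all_st 7%N _).
Qed.

Lemma plpow_drop2 : ~~ (P 2 <= P 3)%VS.
Proof.
apply/negP => P23; have all_st n : (1 < n)%N -> (P n <= P n.+1)%VS.
  elim/ltn_ind: n => -[|[|[|n]]] IHn // _; apply: plpowS_stable => // i j *.
  by have [i1|i1] := leqP i 1; [right | left]; apply: IHn; lia.
exact: P7_stable_false (all_st 7%N _).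
Qed.

Lemma plpow_drop3 : ~~ (P 3 <= P 4)%VS.
Proof.
apply/negP => P34; have all_st n : (2 < n)%N -> (P n <= P n.+1)%VS.
  elim/ltn_ind: n => -[|[|[|[|n]]]] IHn // _.
  case: n IHn => // n IHn; apply: plpowS_stable => // i j *.
  by have [i2|i2] := leqP i 2; [right | left]; apply: IHn; lia.
exact: P7_stable_false (all_st 7%N _).
Qed.

(** Otherwise layers 4, 5 and 6 are all zero, and every splitting of 7 has a
    part among 4, 5, 6, so layer 7 would vanish. *)
Lemma plpow_drop5 : ~~ (P 5 <= P 6)%VS.
Proof.
apply/negP => P56; have st n : (3 < n < 7)%N -> (P n <= P n.+1)%VS.
  by case: n => [|[|[|[|[|[|[|n]]]]]]] // _; apply: plpow6_stable.
apply: P7_stable_false; apply: plpowS_stable => // i j *.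
by have [i3|i3] := leqP i 3; [right | left]; apply: st; lia.
Qed.

(** The four strict drops, together with P_7 <> 0, use up the whole dimension:
    each drop is by one and there is none from P_6 to P_7. *)
Lemma plpow_dims : [/\ \dim (P 3) = 3%N, \dim (P 4) = 2%N & (P 6 <= P 7)%VS].
Proof.
have d12 := dimv_lt (plpowSS A 1) plpow_drop1.
have d23 := dimv_lt (plpowSS A 2) plpow_drop2.
have d34 := dimv_lt (plpowSS A 3) plpow_drop3.
have d56 := dimv_lt (plpowSS A 5) plpow_drop5.
have d67 := dimvS (plpowSS A 6).
have d45 : \dim (P 4) = \dim (P 5).
  by apply/eqP; rewrite eqn_leq !dimvS // plpowSS.
have d7 : (0 < \dim (P 7))%N by rewrite lt0n dimv_eq0; apply/eqP.
move: d12; rewrite plpow1 dimA => d12.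
have P76 : \dim (P 7) == \dim (P 6) by lia.
by split; [lia | lia | rewrite -(dimv_leqif_sup (plpowSS A 6))].
Qed.

(** Layer 4 vanishes by hypothesis, layer 6 by the dimension count, and the
    later ones because P_8 = 0. *)
Lemma plpow_even_stable k : (1 < k)%N -> (P k.*2 <= P k.*2.+1)%VS.
Proof.
case: k => [|[|[|[|k]]]] // _; first by case: plpow_dims.
by rewrite plpow_ge8 ?sub0v //; lia.
Qed.

Lemma x_memP1 : x \in P 1. Proof. exact: memvf. Qed.
Lemma x2_memP2 : x2 \in P 2. Proof. exact: (plpow_mul _ _ x_memP1 x_memP1). Qed.
Lemma a_memP3 : a \in P 3. Proof. exact: (plpow_mul _ _ x2_memP2 x_memP1). Qed.
Lemma b_memP3 : b \in P 3. Proof. exact: (plpow_mul _ _ x_memP1 x2_memP2). Qed.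
Lemma c_memP5 : c \in P 5. Proof. exact: (plpow_mul _ _ x2_memP2 a_memP3). Qed.
Lemma d_memP7 : d \in P 7. Proof. exact: (plpow_mul _ _ x2_memP2 c_memP5). Qed.

(** x^2 (x x^2) = x (x^2 x^2) + (x^2 x) x^2 - (x x^2) x^2; the first term
    contains the zero layer 4, the others are a right multiplication of layer 3
    by x^2. *)
Lemma x2b_memP6 : x2 ** b \in P 6.
Proof.
rewrite plmulCA rpredB ?rpredD //.
- apply: (plpow_mul (i := 1) (j := 5) _ _ x_memP1) => //.
  by apply: (subvP P45); apply: (plpow_mul _ _ x2_memP2 x2_memP2).
- exact: plmul_sqr_right P45 a_memP3.
- exact: plmul_sqr_right P45 b_memP3.
Qed.

Lemma plpow1_cover : (P 1 <= <[x]> + P 2)%VS.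
Proof. exact: plgen_cover. Qed.

Lemma plpow2_cover : (P 2 <= <[x2]> + P 3)%VS.
Proof.
apply: (plpowS_cover (n := 1) (S := fun=> <[x]>%VS)) => //.
  by case=> [|[|i]] // _; apply: plpow1_cover.
move=> i j u v _ _ _ Su Sv.
exact: plmul_vline Su Sv (memv_line _).
Qed.

Lemma plpow3_cover2 : (P 3 <= (<[a]> + <[b]>) + P 4)%VS.
Proof.
apply: (plpowS_cover (n := 2) (S := nth 0%VS [:: 0; <[x]>; <[x2]>]%VS)) => //.
  by case=> [|[|[|i]]] // _; [apply: plpow1_cover | apply: plpow2_cover].
move=> i j u v i_gt0 j_gt0; case: i i_gt0 => [|[|[|i]]] // _ def_j.
- have {def_j} ->: j = 2%N by lia.
  move=> Su Sv; apply: plmul_vline Su Sv _.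
  by rewrite (subvP (addvSr _ _)) ?memv_line.
- have {def_j} ->: j = 1%N by lia.
  move=> Su Sv; apply: plmul_vline Su Sv _.
  by rewrite (subvP (addvSl _ _)) ?memv_line.
- by lia.
Qed.

(** Of the products of layers 2 and 3, in either order, all but x^2 (x^2 x)
    vanish in layer 5. *)
Lemma plpow5_cover : (P 5 <= <[c]> + P 6)%VS.
Proof.
suff: (P 5 <= (<[c]> + P 6) + P 6)%VS by rewrite -addvA addvv.
apply: (plpowS_cover (n := 4)
  (S := nth 0%VS [:: 0; <[x]>; <[x2]>; <[a]> + <[b]>; 0]%VS)) => //.
  case=> [|[|[|[|[|i]]]]] // _; rewrite /= ?add0v //.
  - exact: plpow1_cover.
  - exact: plpow2_cover.
  - exact: plpow3_cover2.
have W6 := subvP (addvSr <[c]> (P 6)).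
move=> i j u v i_gt0 j_gt0 def_ij.
have: i = 1%N /\ j = 4%N \/ i = 2%N /\ j = 3%N \/
      i = 3%N /\ j = 2%N \/ i = 4%N /\ j = 1%N by lia.
case=> [|[|[]]] [-> ->] /= Su Sv.
- by move: Sv; rewrite memv0 => /eqP->; rewrite raddf0 mem0v.
- case/memv_addP: Sv => v1 Sv1 [v2 Sv2 ->]; rewrite plmulDr rpredD //.
    apply: plmul_vline Su Sv1 _.
    by rewrite (subvP (addvSl _ _)) ?memv_line.
  by apply: W6; apply: plmul_vline Su Sv2 x2b_memP6.
- case/memv_addP: Su => u1 Su1 [u2 Su2 ->]; rewrite plmulDl; apply: W6.
  rewrite rpredD //.
    by apply: plmul_vline Su1 Sv _; apply: plmul_sqr_right P45 a_memP3.
  by apply: plmul_vline Su2 Sv _; apply: plmul_sqr_right P45 b_memP3.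
- by move: Su; rewrite memv0 => /eqP->; rewrite -(scale0r 0) plmulZl scale0r
  mem0v.
Qed.

(** Layers 4 and 6 being zero, layer 7 comes from layers 2 and 5 only, and
    right multiplication by x^2 kills layer 5. *)
Lemma plpow7_cover : (P 7 <= <[d]>)%VS.
Proof.
suff: (P 7 <= <[d]> + P 8)%VS by rewrite P8_eq0 addv0.
have P67 : (P 6 <= P 7)%VS by case: plpow_dims.
apply: (plpowS_cover (n := 6)
  (S := nth 0%VS [:: 0; <[x]>; <[x2]>; <[a]> + <[b]>; 0; <[c]>; 0]%VS)) => //.
  case=> [|[|[|[|[|[|[|i]]]]]]] // _; rewrite /= ?add0v //.
  - exact: plpow1_cover.
  - exact: plpow2_cover.
  - exact: plpow3_cover2.
  - exact: plpow5_cover.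
move=> i j u v i_gt0 j_gt0 def_ij.
have: (i = 2%N /\ j = 5%N) \/ (i = 5%N /\ j = 2%N) \/
      (i \in [:: 4; 6]) \/ (j \in [:: 4; 6]) by rewrite !inE; lia.
case=> [[-> ->]|[[-> ->]|[|]]] /= => [Su Sv|Su Sv|i46 Su _|j46 _ Sv].
- exact: plmul_vline Su Sv (memv_line _).
- apply: plmul_vline Su Sv _.
  have: c ** x2 \in P 8 by apply: plmul_sqr_right P67 c_memP5.
  by rewrite P8_eq0 memv0 => /eqP->; rewrite mem0v.
- suff ->: u = 0 by rewrite -(scale0r 0) plmulZl scale0r mem0v.
  move: Su; rewrite !inE in i46.
  by case/orP: i46 => /eqP-> /=; rewrite memv0 => /eqP.
- suff ->: v = 0 by rewrite raddf0 mem0v.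
  move: Sv; rewrite !inE in j46.
  by case/orP: j46 => /eqP-> /=; rewrite memv0 => /eqP.
Qed.

(** Otherwise layer 5, spanned by c, would be zero. *)
Lemma c_notinP6 : c \notin P 6.
Proof.
apply: contra plpow_drop5 => P6c; apply: subv_trans plpow5_cover _.
by rewrite subv_add subvv andbT -memvE.
Qed.

Lemma a_notinP4 : a \notin P 4.
Proof.
apply: contra c_notinP6 => /(subvP P45) P5a.
by apply: (plpow_mul_ge (i := 2) (j := 5) _ _ _ x2_memP2 P5a).
Qed.

Lemma plpow3_cover : (P 3 <= <[a]> + P 4)%VS.
Proof.
have [d3 d4 _] := plpow_dims.
by rewrite subv_line_add ?plpowSS ?d3 ?d4 ?a_memP3 ?a_notinP4.
Qed.

(** Layer 3 is the line of x^2 x, so x x^2 = k (x^2 x) + r with r in P_4;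
    left multiplication by x^2 kills x x^2 and r in layer 5, but not x^2 x. *)
Lemma b_memP5 : b \in P 5.
Proof.
have /memv_addP[_ /vlineP[k ->] [r /(subvP P45) P5r def_b]] :=
  subvP plpow3_cover _ b_memP3.
have P6x2r : x2 ** r \in P 6.
  by apply: (plpow_mul_ge (i := 2) (j := 5) _ _ _ x2_memP2 P5r).
have: k *: c \in P 6.
  have ->: k *: c = x2 ** b - x2 ** r by rewrite def_b plmulDr plmulZr addrK.
  by rewrite rpredB ?x2b_memP6.
have [k0|k_neq0] := eqVneq k 0; last first.
  by rewrite rpredZeq (negPf k_neq0) (negPf c_notinP6).
by move=> _; rewrite def_b k0 scale0r add0r.
Qed.

Lemma thin_basis : basis_of {:A}%VS [:: x; x2; a; c; d].
Proof.
have P67 : (P 6 <= P 7)%VS by case: plpow_dims.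
rewrite basisEdim dimA /= andbT !span_cons span_nil addv0.
have P6d := subv_trans P67 plpow7_cover.
have P5d := subv_trans plpow5_cover (addvS (subvv _) P6d).
have P3d := subv_trans plpow3_cover (addvS (subvv _) (subv_trans P45 P5d)).
have P2d := subv_trans plpow2_cover (addvS (subvv _) P3d).
exact: subv_trans plpow1_cover (addvS (subvv _) P2d).
Qed.

End GradedThinness.

(** * Bracketings *)

Section Bracketings.
Local Open Scope nat_scope.

(** The first argument only bounds the recursion; it is harmless as soon as it
    is at least the number of leaves. *)
Fixpoint bracketings_upto (fuel n : nat) : seq bracketing :=
  if fuel is m.+1 then
    if n == 1 then [:: Leaf] else
    flatten [seq [seq Node s t | s <- bracketings_upto m k,
                                 t <- bracketings_upto m (n - k)]
            | k <- iota 1 n.-1]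
  else [::].

Definition bracketings n := bracketings_upto n n.

Lemma nleaves_gt0 t : 0 < nleaves t.
Proof. by elim: t => //= s IHs t IHt; rewrite addn_gt0 IHs. Qed.

Lemma nleaves1 t : nleaves t = 1 -> t = Leaf.
Proof.
by case: t => //= s t; have := nleaves_gt0 s; have := nleaves_gt0 t; lia.
Qed.

Lemma mem_bracketings_upto fuel n t : n <= fuel ->
  (t \in bracketings_upto fuel n) = (nleaves t == n).
Proof.
elim: fuel n t => [|m IHm] n t len /=.
  by rewrite in_nil; have := nleaves_gt0 t; lia.
have [->|n_neq1] := eqVneq n 1.
  by rewrite inE; apply/eqP/eqP => [-> | /nleaves1].
apply/idP/eqP => [/flatten_mapP[k] | def_n]; last subst n.
  rewrite mem_iota => k_n /allpairsP[[s u] /= []].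
  by rewrite !IHm => [/eqP ds /eqP du ->||] /=; lia.
case: t len n_neq1 => [//|s u] /= len _; apply/flatten_mapP.
have := nleaves_gt0 s; have := nleaves_gt0 u => u_gt0 s_gt0.
exists (nleaves s); first by rewrite mem_iota; lia.
by apply/allpairsP; exists (s, u); split=> //; rewrite IHm /=; lia.
Qed.

Lemma mem_bracketings n t : (t \in bracketings n) = (nleaves t == n).
Proof. exact: mem_bracketings_upto. Qed.

End Bracketings.

Section Evaluation.
Variables (F : fieldType) (A : preLieVectType F) (x : A).

Lemma plval_plpow t : plval x t \in plpow A (nleaves t).
Proof.
elim: t => [|s IHs t IHt] /=; first exact: memvf.
by apply: plpow_mul => //; apply: nleaves_gt0.
Qed.

(** Layer 1 is spanned by x because x generates, and the spanning sets of lower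
    layers multiply to one of layer n by [plpowS_cover]. *)
Lemma plpow_bracketings n (U : {vspace A}) : plgenerates x -> (0 < n)%N ->
  (forall t, nleaves t = n -> plval x t \in U) ->
  (plpow A n <= U + plpow A n.+1)%VS.
Proof.
move=> x_gen; pose S k := <<[seq plval x t | t <- bracketings k]>>%VS.
have S_mem t : plval x t \in S (nleaves t).
  by apply: memv_span; apply: map_f; rewrite mem_bracketings.
suff cover k : (0 < k)%N -> (plpow A k <= S k + plpow A k.+1)%VS.
  move=> n_gt0 sU; apply: subv_trans (cover n n_gt0) (addvS _ (subvv _)).
  by apply/span_subvP => _ /mapP[t + ->]; rewrite mem_bracketings => /eqP/sU.
elim/ltn_ind: k => -[|[|k]] IHk // _.
  apply: subv_trans (plgen_cover x_gen) (addvS _ (subvv _)).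
  by rewrite -memvE; apply: (S_mem Leaf).
apply: plpowS_cover => // [i lt_i | i j u v _ _ def_ij].
  by apply: IHk; lia.
rewrite -def_ij; apply: plmul_span => _ _ /mapP[s + ->] /mapP[t + ->].
rewrite !mem_bracketings => /eqP ds /eqP dt.
by have := S_mem (Node s t); rewrite /= ds dt.
Qed.

End Evaluation.

(** * Weights of bracketings *)

(** Even layers from 4 on are zero, so such an index can be raised by one. *)
Definition round_weight n := if (2 < n)%N && ~~ odd n then n.+1 else n.

(** An index of the filtration in which the value of the bracketing is known to
    lie. The value 5 is for x x^2, and the increment 3 is the extra step gained
    by right multiplication by x^2. *)
Fixpoint plweight (t : bracketing) : nat :=
  if t is Node s u then
    round_weight
      (if u == Node Leaf Leaf then
         if s == Leaf then 5
         else if (2 < plweight s)%N then (plweight s + 3)%N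
         else (plweight s + 2)%N
       else (plweight s + plweight u)%N)
  else 1%N.

Lemma plweight_gt0 t : (0 < plweight t)%N.
Proof.
elim: t => //= s IHs t IHt; rewrite /round_weight.
by do ![case: ifP => _]; lia.
Qed.

(** Oddness is what makes the layer after that of s zero, hence what gives the
    extra step for s ** x^2. *)
Lemma plweight_odd t : (2 < plweight t)%N -> odd (plweight t).
Proof. by case: t => //= s t; rewrite /round_weight; case: ifP; lia. Qed.

Section Weight.
Variables (F : fieldType) (A : preLieVectType F) (x : A).
Hypothesis even_stable :
  forall k, (1 < k)%N -> (plpow A k.*2 <= plpow A k.*2.+1)%VS.
Hypothesis xx2_P5 : x ** (x ** x) \in plpow A 5.

Lemma round_weight_sub n : (plpow A n <= plpow A (round_weight n))%VS.
Proof.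
rewrite /round_weight; case: ifP => // /andP[n_gt2 n_even].
rewrite -[n]even_halfK //; apply: even_stable; lia.
Qed.

Lemma plval_weight t : plval x t \in plpow A (plweight t).
Proof.
elim: t => [|s IHs t IHt] /=; first exact: memvf.
apply: (subvP (round_weight_sub _)).
have [def_t|_] := eqVneq t (Node Leaf Leaf); last first.
  by apply: plpow_mul; rewrite ?plweight_gt0.
rewrite {}def_t /= in IHt *.
have [->|_] := eqVneq s Leaf; first exact: xx2_P5.
case: ifP => [s_gt2|_]; last by apply: plpow_mul; rewrite ?plweight_gt0.
rewrite addn3; apply: plmul_sqr_right; rewrite ?plweight_gt0 //.
have s_odd := plweight_odd s_gt2.
have -> : plweight s = (plweight s)./2.*2.+1 by lia.
rewrite -doubleS; apply: even_stable; lia.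
Qed.

End Weight.

Lemma bracketings6_heavy :
  let X := Leaf in let X2 := Node X X in
  all (fun t => (t \in [:: X ** (X2 ** (X2 ** X));
                     (X2 ** (X2 ** X)) ** X;
                     X2 ** (X ** (X2 ** X));
                     X2 ** ((X2 ** X) ** X);
                     X2 ** (X2 ** X2);
                     (X2 ** X) ** (X2 ** X);
                     ((X2 ** X) ** X) ** X2;
                     (X ** (X2 ** X)) ** X2]%BKT) || (7 < plweight t)%N)
    (bracketings 6).
Proof. by vm_compute. Qed.

(** * The main theorem *)

(** An additive map between vector spaces over a prime field is linear. *)
Lemma dim_additive_bij p n (V : vectType 'F_p) : prime p ->
  (exists f : {additive V -> 'rV['F_p]_n}, bijective f) ->
  \dim {:V} = n.
Proof.
move=> p_prime [f f_bij].
have f_lin : linear f.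
  move=> k u v; rewrite raddfD; congr (_ + _).
  by rewrite -[k]natr_Zp !scaler_nat raddfMn.
pose fL := linfun (HB.pack_for {linear V -> 'rV['F_p]_n} (f : V -> 'rV_n)
   (GRing.isLinear.Build _ _ _ _ (f : V -> 'rV_n) f_lin)).
have fLE u : fL u = f u by rewrite lfunE.
have [g fK gK] := f_bij.
have ker0 : lker fL = 0%VS.
  apply/eqP; rewrite -subv0; apply/subvP => u; rewrite memv_ker fLE memv0.
  by rewrite -{1}(raddf0 f) (inj_eq (can_inj fK)).
have img : limg fL = fullv.
  apply/eqP; rewrite eqEsubv subvf; apply/subvP => w _.
  by rewrite -[w]gK -fLE memv_img ?memvf.
rewrite -(limg_dim_eq (_ : fullv :&: lker fL = 0)%VS) ?ker0 ?capv0 //.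
by rewrite img dimvf /dim /= mul1n.
Qed.

Theorem theorem4p1p4 (p : nat) (p_prime : prime p)
    (A : preLieVectType 'F_p)
    (A_C_p_5 : exists f : {additive A -> 'rV['F_p]_5}, bijective f)
    (x : A) (x_gen : plgenerates x)
    (A7_neq0 : plpow A 7 <> 0%VS) (A8_eq0 : plpow A 8 = 0%VS)
    (A5_eq_A4 : plpow A 5 = plpow A 4) :
  let x2 := x ** x in
  let X := Leaf in
  let X2 := Node X X in
  (* (1) *)
  basis_of {:A}%VS [:: x; x2; x2 ** x; x2 ** (x2 ** x);
                       x2 ** (x2 ** (x2 ** x))] /\
  (* (2) *)
  x ** x2 \in plpow A 4 /\
  (* (3) *)
  ((exists alpha1 alpha2 : 'F_p,
      x ** (x2 ** x) - alpha1 *: (x2 ** (x2 ** x)) \in plpow A 6 /\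
      (x2 ** x) ** x - alpha2 *: (x2 ** (x2 ** x)) \in plpow A 6) /\
   (x2 ** x) ** x - x2 ** x2 = (x ** x2) ** x - x ** (x2 ** x)) /\
  (* (4) *)
  [/\ x ** (x ** (x ** x2)) = 0,
      (x ** (x ** x2)) ** x = 0,
      x ** ((x ** x2) ** x) = 0,
      ((x ** x2) ** x) ** x = 0 &
      (x ** x2) ** x2 = 0] /\
  (* (5) *)
  [/\ forall t : bracketing, nleaves t = 6%N -> plval x t \in plpow A 6,
      forall U : {vspace A},
        (forall t : bracketing, nleaves t = 6%N -> plval x t \in U) ->
        (plpow A 6 <= U + plpow A 7)%VS &
      forall t : bracketing, nleaves t = 6%N ->
        t \notin [:: X ** (X2 ** (X2 ** X));
                     (X2 ** (X2 ** X)) ** X;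
                     X2 ** (X ** (X2 ** X));
                     X2 ** ((X2 ** X) ** X);
                     X2 ** (X2 ** X2);
                     (X2 ** X) ** (X2 ** X);
                     ((X2 ** X) ** X) ** X2;
                     (X ** (X2 ** X)) ** X2]%BKT ->
        plval x t = 0] /\
  (* (6) *)
  [/\ plpow A 7 = plpow A 6,
      plpow A 6 = <[x2 ** (x2 ** (x2 ** x))]>%VS,
      plpow A 5 = plpow A 4,
      quot_span1 (plpow A 5) (plpow A 6) (x2 ** (x2 ** x)) /\
      quot_span1 (plpow A 4) (plpow A 6) (x2 ** (x2 ** x)) &
      quot_span1 (plpow A 3) (plpow A 4) (x2 ** x)].
Proof.
move=> x2 X X2.
have dimA := dim_additive_bij p_prime A_C_p_5.
have P45 : (plpow A 4 <= plpow A 5)%VS by rewrite A5_eq_A4.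
have [_ _ P67] := plpow_dims dimA A7_neq0 A8_eq0 P45.
have P5b : x ** x2 \in plpow A 5 by apply: b_memP5.
have P6_eq_P7 : plpow A 7 = plpow A 6.
  by apply/eqP; rewrite eqEsubv plpowSS.
have P6_line : plpow A 6 = <[x2 ** (x2 ** (x2 ** x))]>%VS.
  by apply/eqP; rewrite -P6_eq_P7 eqEsubv plpow7_cover // -memvE d_memP7.
have heavy0 t : (7 < plweight t)%N -> plval x t = 0.
  move=> t_heavy; apply/eqP; rewrite -memv0 -A8_eq0.
  apply: (subvP (plpow_sub A t_heavy)); apply: (plval_weight _ P5b).
  exact: plpow_even_stable.
have quot (U V : {vspace A}) (a : A) :
    (V <= U)%VS -> (U <= <[a]> + V)%VS -> a \in U -> quot_span1 U V a.
  move=> sVU /subvP sUaV Ua; split=> // u.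
  move=> /sUaV/memv_addP[_ /vlineP[k ->] [v Vv ->]].
  by exists k; rewrite addrAC subrr add0r.
have quot5 : quot_span1 (plpow A 5) (plpow A 6) (x2 ** (x2 ** x)).
  by apply: quot; [apply: plpowSS | apply: plpow5_cover | apply: c_memP5].
split; first exact: thin_basis.
split; first by rewrite -A5_eq_A4.
split.
  split; last exact: plmul_assocC.
  have [_ _ quot_ex] := quot5; rewrite A5_eq_A4 in quot_ex.
  have [k1 Pk1] : exists k,
      x ** (x2 ** x) - k *: (x2 ** (x2 ** x)) \in plpow A 6.
    by apply: quot_ex; apply: (plval_plpow x (X ** (X2 ** X))%BKT).
  have [k2 Pk2] : exists k,
      (x2 ** x) ** x - k *: (x2 ** (x2 ** x)) \in plpow A 6.
    by apply: quot_ex; apply: (plval_plpow x ((X2 ** X) ** X)%BKT).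
  by exists k1, k2.
split.
  split.
  - exact: (heavy0 (X ** (X ** (X ** X2)))%BKT).
  - exact: (heavy0 ((X ** (X ** X2)) ** X)%BKT).
  - exact: (heavy0 (X ** ((X ** X2) ** X))%BKT).
  - exact: (heavy0 (((X ** X2) ** X) ** X)%BKT).
  - exact: (heavy0 ((X ** X2) ** X2)%BKT).
split.
  split.
  - by move=> t <-; apply: plval_plpow.
  - by move=> U; apply: plpow_bracketings.
  - move=> t t6 t_notin; apply: heavy0.
    have := allP bracketings6_heavy t; rewrite mem_bracketings t6 => /(_ isT).
    by rewrite (negPf t_notin).
split=> //; first by split; rewrite -?A5_eq_A4.
by apply: quot; [apply: plpowSS | apply: plpow3_cover | apply: a_memP3].
Qed.
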